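(* If $T$ is a tree, then $\gamma(T)=\nu_2(T)$.
   Context: A tree is a simple connected graph without cycles. For a graph $G$ with vertex set $V$, let $X_G=\{x_u\mid u\in V\}$ be indeterminates and $L(G,X_G)$ the matrix with $L_{u,u}=x_u$ and $L_{u,v}=-m_{uv}$ ($u\neq v$), $m_{uv}$ the number of edges between $u$ and $v$. The $j$-critical ideal $I_j(G,X_G)\subseteq\mathbb{Z}[X_G]$ is generated by all $j\times j$ minors of $L(G,X_G)$. The algebraic co-rank is $\gamma(G)=\max\{j\mid I_j(G,X_G)=\mathbb{Z}[X_G]\}$ (taken to be $0$ if there is no such $j$). A $2$-matching of $G$ is a set of edges such that every vertex is incident to at most two of them; $\nu_2(G)$ is the maximum number of edges in a $2$-matching of $G$. *)

(* Defs.v *)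
From HB Require Import structures.
From mathcomp Require Import all_boot all_order all_algebra.
From mathcomp Require Import mpoly.
From Stdlib Require Import ClassicalEpsilon.
Set Implicit Arguments. Unset Strict Implicit. Unset Printing Implicit Defensive.
Import Order.TTheory GRing.Theory Num.Theory.

Definition simple_graph n (e : rel 'I_n) : Prop :=
  ssrbool.symmetric e /\ ssrbool.irreflexive e.

Definition connected_graph n (e : rel 'I_n) : Prop :=
  forall u v : 'I_n, connect e u v.

Definition acyclic_graph n (e : rel 'I_n) : Prop :=
  forall c : seq 'I_n, ucycle e c -> size c < 3.

Definition is_tree n (e : rel 'I_n) : Prop :=
  [/\ simple_graph e, connected_graph e & acyclic_graph e].

Local Open Scope ring_scope.

Definition genLap n (e : rel 'I_n) : 'M[{mpoly int[n]}]_n :=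
  \matrix_(u, v) (if u == v then 'X_u else - ((e u v)%:R)).

Definition minor n j (A : 'M[{mpoly int[n]}]_n) (f g : {ffun 'I_j -> 'I_n}) :
  {mpoly int[n]} := \det (\matrix_(a, b) A (f a) (g b)).

(* I_j(G, X_G) = Z[X_G], i.e. 1 lies in the ideal generated by all j x j minors. *)
Definition critical_ideal_trivial n (e : rel 'I_n) (j : nat) : Prop :=
  exists c : {ffun {ffun 'I_j -> 'I_n} * {ffun 'I_j -> 'I_n} -> {mpoly int[n]}},
    \sum_(p : {ffun 'I_j -> 'I_n} * {ffun 'I_j -> 'I_n} | injectiveb p.1 && injectiveb p.2) c p * minor (genLap e) p.1 p.2 = 1.

Definition propb (P : Prop) : bool :=
  if excluded_middle_informative P then true else false.

(* algebraic co-rank: max j with I_j = Z[X_G] (I_j = 0 for j > n, I_0 = Z[X]). *)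
Definition gamma n (e : rel 'I_n) : nat :=
  \max_(j < n.+1 | propb (critical_ideal_trivial e j)) j.

Local Close Scope ring_scope.

Definition two_matching n (e : rel 'I_n) (M : {set 'I_n * 'I_n}) : bool :=
  [forall p in M, (p.1 < p.2) && e p.1 p.2] &&
  [forall w : 'I_n, #|[set p in M | (p.1 == w) || (p.2 == w)]| <= 2].

Definition nu2 n (e : rel 'I_n) : nat :=
  \max_(M : {set 'I_n * 'I_n} | two_matching e M) #|M|.

(* Main.v *)
Require Import Defs.
From mathcomp Require Import all_boot all_order all_algebra.
From mathcomp Require Import perm mpoly.
From Stdlib Require Import ClassicalEpsilon.
Set Implicit Arguments. Unset Strict Implicit. Unset Printing Implicit Defensive.
Import Order.TTheory GRing.Theory Num.Theory.

(** Let h order the vertices of a forest so that each vertex has at most one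
    neighbour higher up, its parent. From the leaves upwards, put v in A when at
    most one child of v is already in A, and set r = 2 |V \ A| + |E(T[A])|.
    - gamma <= r: give x_u the degree of u in T[A] (so 0 outside A). The
      restriction of L to A becomes the Laplacian of T[A], of rank at most
      |E(T[A])|, and the rows and columns outside A add rank at most 2 each.
    - r <= nu_2: each v outside A picks two of its children in A, each v in A
      picks its only child in A, if any; these edges form a 2-matching.
    - nu_2 <= gamma: a 2-matching is a disjoint union of paths. Orienting each of
      them, the arcs (tail, head) index the diagonal of a submatrix of L that is
      triangular, with -1 on the diagonal. *)

(** * Recursion along a measure *)

(** At [x] the iterates of [F] agree from step [mu x + 1] on, because [F] looks only at points of
    smaller measure. *)
Lemma wf_fixpoint (T : Type) (mu : T -> nat) (F : (T -> bool) -> T -> bool) :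
    (forall f g x, (forall y, mu y < mu x -> f y = g y) -> F f x = F g x) ->
  exists f, f =1 F f.
Proof.
move=> Floc; pose it k := iter k F xpredT.
have itE k l x : mu x < k -> mu x < l -> it k x = it l x.
  elim: k l x => // k IHk [|l] // x xk xl; apply: Floc => y yx.
  by apply: IHk; apply: leq_trans yx _.
exists (fun x => it (mu x).+1 x) => x; apply: Floc => y yx.
by apply: itE.
Qed.

(** * Elimination orders of forests *)

Section Graph.

Variables (n : nat) (e : rel 'I_n).

(** In a simple graph: when vertices are removed by increasing [h], each has at most one neighbour
    left at its turn. *)
Definition elimination_order (h : 'I_n -> nat) : Prop :=
  injective h /\
  forall u v w, e u v -> e u w -> h u < h v -> h u < h w -> v = w.

(* Without a leaf, every path in S extends at its head without repeating a vertex: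
   two neighbours of the head both on the path would close a cycle. *)
Lemma acyclic_leaf (S : {set 'I_n}) :
    simple_graph e -> acyclic_graph e -> S != set0 ->
  exists2 x, x \in S & {in S &, forall v w, e x v -> e x w -> v = w}.
Proof.
move=> [esym eirr] eacy /set0Pn[x0 x0S]; apply: NNPP => noleaf.
have branch x : x \in S -> exists v w, [/\ v \in S, w \in S, e x v, e x w & v != w].
  move=> xS; apply: NNPP => nobr; apply: noleaf; exists x => // v w vS wS xv xw.
  by apply/eqP/negPn/negP => vw; apply: nobr; exists v, w.
have long k : exists x p, [/\ size p = k, path e x p, uniq (x :: p) & {subset x :: p <= S}].
  elim: k => [|k [x [p [szp pp up pS]]]].
    by exists x0, [::]; split=> // y; rewrite inE => /eqP->.
  have [v [w [vS wS xv xw vw]]] := branch x (pS x (mem_head _ _)).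
  have ext y : y \in S -> e x y -> y \notin x :: p ->
      exists x p, [/\ size p = k.+1, path e x p, uniq (x :: p) & {subset x :: p <= S}].
    move=> yS xy yp; exists y, (x :: p); split=> //=; first by rewrite szp.
    - by rewrite esym xy.
    - by move: yp up => /= -> ->.
    by move=> z; rewrite inE => /predU1P[->|/pS].
  case vp: (v \in x :: p); last by apply: (ext v); rewrite ?vp.
  case wp: (w \in x :: p); last by apply: (ext w); rewrite ?wp.
  (* A neighbour [y] on the path comes right after the head [x]: otherwise the stretch from [x] to
     [y] closes a cycle of length at least 3. *)
  have close y : e x y -> y \in x :: p -> index y p = 0.
    move=> xy; rewrite inE; case/predU1P=> [yx|yp]; first by rewrite yx eirr in xy.
    apply/eqP; rewrite -leqn0 leqNgt; apply/negP => i0.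
    case/splitPr: yp i0 pp up => p1 p2; rewrite index_cat /=.
    case: ifP => [yp1 _ _|yp1]; first by rewrite /= cat_uniq /= yp1 !andbF.
    rewrite eqxx addn0 => p10; rewrite -cat_rcons cat_path.
    rewrite mem_cat cat_uniq negb_or.
    case/andP=> pp1 _ /andP[/andP[xp1 _] /and3P[up1 _ _]].
    have := eacy (x :: rcons p1 y); rewrite /= size_rcons /ucycle /= rcons_path pp1.
    rewrite last_rcons (esym y) xy xp1 up1 => /(_ isT).
    by case: (p1) p10.
  have pv : v \in p by move: vp xv; rewrite inE => /predU1P[->|//]; rewrite eirr.
  have := close v xv vp; rewrite -(close w xw wp) => /(congr1 (nth x p)).
  rewrite !nth_index // => [vwE|]; first by rewrite vwE eqxx in vw.
  by move: wp xw; rewrite inE => /predU1P[->|//]; rewrite eirr.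
(* Such a path has [n + 1] distinct vertices, one too many. *)
have [x [p [szp _ up _]]] := long n.
have := max_card (mem (x :: p)); rewrite card_ord (card_uniqP up) /= szp.
by rewrite ltnn.
Qed.

(** Leaves are stripped one by one: a vertex with at most one neighbour in [S] gets height 0, and
    the heights of the others shift up by one. *)
Lemma acyclic_elimination_order :
  simple_graph e -> acyclic_graph e -> exists h, elimination_order h.
Proof.
move=> esimp eacy.
suff ord_on k (S : {set 'I_n}) : #|S| = k -> exists h : 'I_n -> nat,
    {in S &, injective h} /\ {in S & &, forall u v w,
       e u v -> e u w -> h u < h v -> h u < h w -> v = w}.
  have [h [hinj hup]] := ord_on _ [set: 'I_n] erefl.
  by exists h; split=> [u v|u v w]; [apply: hinj | apply: hup].
elim: k S => [|k IHk] S Sk.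
  by exists (fun=> 0); split=> [u|u]; rewrite (cards0_eq Sk) inE.
have S0 : S != set0 by rewrite -card_gt0 Sk.
have [x xS xleaf] := acyclic_leaf esimp eacy S0.
have [|h [hinj hup]] := IHk (S :\ x).
  by apply/eqP; rewrite -eqSS -Sk [in X in _ == X](cardsD1 x) xS.
exists (fun u => if u == x then 0 else (h u).+1); split=> [u v|u v w] uS vS.
  case: eqP => [->|/eqP ux]; case: eqP => [->|/eqP vx] // [].
  by apply: hinj; rewrite !inE ?ux ?vx.
move=> wS; case: (u =P x) => [->|/eqP ux]; first by move=> ? ? _ _; apply: xleaf.
case: (v =P x) => // /eqP vx; case: (w =P x) => // /eqP wx.
by rewrite !ltnS; apply: hup; rewrite !inE ?ux ?vx ?wx.
Qed.

(** * Edges as ordered pairs *)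

Lemma card_set_pairs (P : rel 'I_n) :
  #|[set p | P p.1 p.2]| = \sum_v #|[set c | P c v]|.
Proof.
rewrite -sum1dep_card -(pair_big_dep xpredT P (fun _ _ => 1)) /=.
rewrite (exchange_big_dep xpredT) //=; apply: eq_bigr => v _.
by rewrite sum1dep_card.
Qed.

(** For [h] injective and [m] symmetric and irreflexive, each edge is listed once. Taking the vertex
    index as [h] gives the encoding of [two_matching]. *)
Definition ascents (h : 'I_n -> nat) (m : rel 'I_n) : {set 'I_n * 'I_n} :=
  [set p | (h p.1 < h p.2) && m p.1 p.2].

(** Reversing the pairs on which [h'] does not increase is injective. Used both ways, this shows
    that the count does not depend on the order. *)
Lemma card_ascents (h h' : 'I_n -> nat) (m : rel 'I_n) :
    injective h -> injective h' -> ssrbool.symmetric m -> ssrbool.irreflexive m ->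
  #|ascents h m| <= #|ascents h' m|.
Proof.
move=> hinj h'inj msym mirr.
pose phi (p : 'I_n * 'I_n) := if h' p.1 < h' p.2 then p else (p.2, p.1).
have phiinj : {in ascents h m &, injective phi}.
  move=> [a b] [c d]; rewrite !inE /= => /andP[ab _] /andP[cd _]; rewrite /phi /=.
  by case: ifP => _; case: ifP => _ [] ac bd; subst=> //; move: ab; rewrite ltnNge ltnW.
rewrite -(card_in_imset phiinj); apply/subset_leq_card/subsetP => q.
case/imsetP=> [[a b]]; rewrite inE /= => /andP[ab mab] ->; rewrite /phi /=.
case: ltnP => h'ab; rewrite inE /= ?h'ab ?mab // msym mab andbT ltn_neqAle h'ab andbT.
by apply/eqP => /h'inj ba; rewrite ba mirr in mab.
Qed.

Lemma ascents_degree (h : 'I_n -> nat) (m : rel 'I_n) w :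
    injective h -> ssrbool.symmetric m -> ssrbool.irreflexive m ->
  #|[set p in ascents h m | (p.1 == w) || (p.2 == w)]| = #|[set u | m w u]|.
Proof.
move=> hinj msym mirr; pose phi u : 'I_n * 'I_n := if h w < h u then (w, u) else (u, w).
have phiinj : {in [set u | m w u] &, injective phi}.
  by move=> u v _ _; rewrite /phi; case: ltnP => _; case: ltnP => _ [] //; congruence.
rewrite -(card_in_imset phiinj); apply: eq_card => -[a b]; rewrite !inE /=.
apply/idP/imsetP => [|[u]].
  case/andP=> /andP[ab mab] /orP[] /eqP abw; subst w.
    by exists b; rewrite ?inE // /phi ab.
  by exists a; rewrite ?inE 1?msym // /phi ltnNge ltnW.
rewrite inE /phi => mwu; case: ltnP => wu [-> ->].
  by rewrite wu mwu eqxx.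
rewrite msym mwu eqxx orbT !andbT ltn_neqAle wu andbT.
by apply/eqP => /hinj uw; rewrite uw mirr in mwu.
Qed.

(** * The greedy set and its 2-matching *)

Definition induced (A : {set 'I_n}) : rel 'I_n :=
  [rel u v | [&& u \in A, v \in A & e u v]].

Definition children (h : 'I_n -> nat) (A : {set 'I_n}) (v : 'I_n) : {set 'I_n} :=
  [set c in A | (h c < h v) && e c v].

(** The condition at [v] involves only lower vertices, so it defines [A] by recursion on [h]. *)
Lemma greedy_set (h : 'I_n -> nat) :
  exists A : {set 'I_n}, forall v, (v \in A) = (#|children h A v| <= 1).
Proof.
have [|f fE] := @wf_fixpoint _ h
   (fun f v => #|[set c | f c && ((h c < h v) && e c v)]| <= 1).
  move=> f g v fg; congr (_ <= 1); apply: eq_card => c; rewrite !inE.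
  by case: ltnP => [/fg->|]; rewrite ?andbF.
exists [set v | f v] => v; rewrite inE fE; congr (_ <= 1).
by apply: eq_card => c; rewrite !inE.
Qed.

Lemma greedy_matching (h : 'I_n -> nat) (A : {set 'I_n}) :
    simple_graph e -> elimination_order h ->
    (forall v, (v \in A) = (#|children h A v| <= 1)) ->
  #|~: A|.*2 + #|ascents h (induced A)| <= nu2 e.
Proof.
move=> [esym eirr] [hinj hup] AE.
(* The children in [A] picked by [v]: two of them if [v] is outside [A], all of them (at most one)
   if [v] is in [A]. *)
pose K v := [set c in take 2 (enum (children h A v))].
have KA c v : c \in K v -> [/\ c \in A, h c < h v & e c v].
  by rewrite inE => /mem_take; rewrite mem_enum inE => /and3P.
have Kcard v : #|K v| = minn 2 #|children h A v|.
  rewrite cardsE (card_uniqP _) ?take_uniq ?enum_uniq // size_take_min.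
  by rewrite cardE.
pose m u v := (u \in K v) || (v \in K u).
have msym : ssrbool.symmetric m by move=> u v; rewrite /m orbC.
have mirr : ssrbool.irreflexive m.
  by move=> u; rewrite /m orbb; apply/negP => /KA[_]; rewrite ltnn.
pose M := ascents (@nat_of_ord n) m.
have MK : #|M| = \sum_v #|K v|.
  transitivity #|ascents h m|.
    by apply/eqP; rewrite eqn_leq !card_ascents //; apply: ord_inj.
  rewrite (card_set_pairs (fun c v => (h c < h v) && m c v)).
  apply: eq_bigr => v _; apply: eq_card => c; rewrite inE /m.
  apply/andP/idP => [[cv /orP[//|/KA[_ vc _]]]|cK].
    by rewrite ltnNge ltnW in cv.
  by have [_ -> _] := KA _ _ cK; rewrite cK.
suff Mtwo : two_matching e M.
  (* Pairs are counted at their upper end [v]. Outside [A], [v] picks two children and is the top of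
     no edge of T[A]; inside, [K v] contains every child in [A]. *)
  apply: leq_trans (leq_bigmax_cond _ Mtwo); rewrite MK.
  rewrite (card_set_pairs (fun c v => (h c < h v) && induced A c v)).
  rewrite -mul2n mulnC -sum_nat_const [X in _ <= X](bigID (mem A)) /= addnC.
  rewrite [X in X + _](bigID (mem A)) /= [X in _ + X + _]big1 ?addn0; last first.
    move=> v vA; apply/eqP; rewrite cards_eq0; apply/eqP/setP => c.
    by rewrite !inE /induced /= (negPf vA) !andbF.
  apply: leq_add; last first.
    rewrite (eq_bigl (fun v => v \notin A)) => [|v]; last by rewrite inE.
    apply: leq_sum => v; rewrite AE -ltnNge Kcard => a2.
    by rewrite (minn_idPl _).
  apply: leq_sum => v vA; rewrite Kcard (minn_idPr _); last first.
    by apply: ltnW; rewrite AE in vA.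
  by apply/subset_leq_card/subsetP => c; rewrite !inE /induced /= vA => /and3P[-> -> ->].
apply/andP; split.
  apply/forall_inP => p; rewrite inE => /andP[-> /orP[]/KA[_ _] //].
  by rewrite esym.
apply/forallP => w; rewrite (ascents_degree _ (@ord_inj n)) //.
(* The neighbours of [w] pick it or are picked by it. In [A], only the parent can pick [w], and [w]
   picks at most one; outside [A], nobody picks [w]. *)
have -> : [set u | m w u] = [set u | w \in K u] :|: K w.
  by apply/setP => u; rewrite in_setU [LHS]in_set [X in X || _]in_set.
apply: leq_trans (leq_card_setU _ _) _.
have [wA|wA] := boolP (w \in A).
  apply: (@leq_add _ _ 1 1); last by rewrite Kcard geq_min -AE wA orbT.
  rewrite leqNgt; apply/negP => /card_gt1P[u [v [uK vK]]].
  move: uK vK; rewrite in_set => /KA[_ wu ewu]; rewrite in_set => /KA[_ wv ewv].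
  by rewrite (hup w u v) ?eqxx.
suff -> : [set u | w \in K u] = set0 by rewrite cards0 Kcard geq_minl.
apply/setP => u; rewrite in_set [RHS]inE; apply/negP => /KA[wA'].
by rewrite wA' in wA.
Qed.

(** * Orienting the paths of a 2-matching *)

(* [dir c] is meaningful only if c has an m-neighbour v higher up: the edge is
   then oriented downwards, from v to c, iff [dir c]. *)
Lemma two_matching_orientation (h : 'I_n -> nat) (m : rel 'I_n) :
    elimination_order h -> ssrbool.symmetric m -> subrel m e ->
    (forall w, #|[set u | m w u]| <= 2) ->
  exists dir : 'I_n -> bool,
    (forall c v w, m c v -> m v w -> h c < h v -> h v < h w -> dir c = dir v) /\
    (forall c c' v, m c v -> m c' v -> h c < h v -> h c' < h v -> c != c' ->
       dir c != dir c').
Proof.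
move=> [hinj hup] msym me mdeg.
pose up u v := m u v && (h u < h v).
pose N := \max_i h i.
have hN i : h i <= N by apply: leq_bigmax.
pose F (dir : 'I_n -> bool) c :=
  (* Recursion from the top down: below a parent that is not the top of its path, the direction is
     inherited; at the top, exactly the child chosen by [pick] is directed downwards. *)
  if [pick v | up c v] is Some v then
    if [exists w, up v w] then dir v else [pick d | up d v] == Some c
  else true.
have [|dir dirE] := @wf_fixpoint _ (fun c => N - h c) F.
  move=> f g c fg; rewrite /F; case: pickP => // v /andP[_ cv].
  by case: ifP => // _; apply: fg; rewrite ltn_sub2l // (leq_trans cv).
have upE c v : up c v -> [pick v | up c v] = Some v.
  move=> cv; case: pickP => [w cw|/(_ v)]; last by rewrite cv.
  case/andP: cv cw => [/me ecv cv] /andP[/me ecw cw].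
  by rewrite (hup c w v).
have three a b c v : m a v -> m b v -> m c v -> a != b -> a != c -> b != c -> False.
  move=> av bv cv ab ac bc; have := mdeg v; rewrite leqNgt => /negP; apply.
  by apply/card_gt2P; exists a, b, c; rewrite !inE !(msym v) (eq_sym c).
exists dir; split=> [c v w cv vw hcv hvw|c c' v cv c'v hcv hc'v cc'].
  rewrite dirE /F (upE c v) /up ?cv ?hcv //; case: existsP => // -[].
  by exists w; rewrite vw.
rewrite !dirE /F (upE c v) ?(upE c' v) /up ?cv ?hcv ?c'v ?hc'v //.
(* A matched parent [w] of [v] would be a third neighbour, so [v] is a top; likewise [pick] must
   choose [c] or [c']. *)
case: existsP => [[w /andP[vw hvw]]|_].
  have wn u : h u < h v -> u != w.
    by apply: contraTneq => ->; rewrite -leqNgt ltnW.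
  by case: (three c c' w v) => //; rewrite ?wn // msym.
case: pickP => [d /andP[dv hdv]|/(_ c)]; last by rewrite cv hcv.
apply/negP => /eqP dd; case: (d =P c) => [dc|/eqP dc].
  by move: dd cc'; rewrite dc !(inj_eq Some_inj) eqxx => /esym/eqP->; rewrite eqxx.
have [dc'|dc'] := eqVneq d c'.
  by move: dd; rewrite !(inj_eq Some_inj) dc' eqxx => /eqP E; rewrite E eqxx in cc'.
exact: three dv cv c'v dc dc' cc'.
Qed.

End Graph.

(** * Determinants and rank *)

Local Open Scope ring_scope.

(* A permutation s contributing to the determinant satisfies rk a <= rk (s a), and
   the two sides have the same sum over a, so s = 1. *)
Lemma det_ranked (R : comNzRingType) j (B : 'M[R]_j) (rk : 'I_j -> nat) :
    (forall a b, a != b -> B a b != 0 -> (rk a < rk b)%N) ->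
  \det B = \prod_a B a a.
Proof.
move=> Brk; rewrite /determinant (bigD1 (1%g : 'S_j)) //= odd_perm1 expr0 mul1r.
under eq_bigr do rewrite perm1.
rewrite [X in _ + X]big1 ?addr0 // => s s1.
have [a /eqP Ba|Bs] := pickP (fun a => B a (s a) == 0).
  by rewrite (bigD1 a) //= Ba mul0r mulr0.
case/eqP: s1; apply/permP => a; rewrite perm1.
have rks b : (rk b <= rk (s b) ?= iff (s b == b))%N.
  have [->|sb] := eqVneq (s b) b; first exact/leqif_refl.
  apply/leqifP; apply: Brk; first by rewrite eq_sym.
  by rewrite Bs.
have [_] := leqif_sum (fun (b : 'I_j) (_ : xpredT b) => rks b).
rewrite {1}(reindex_inj (@perm_inj _ s)) /= eqxx.
by move=> /esym/forallP/(_ a)/eqP.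
Qed.

Lemma mxrank_sum_outer (F : fieldType) n (I : finType) (S : {set I})
    (u : I -> 'cV[F]_n) (v : I -> 'rV[F]_n) :
  (\rank (\sum_(i in S) u i *m v i)%R <= #|S|)%N.
Proof.
rewrite -sum1_card; apply: (big_ind2 (fun (M : 'M_n) k => \rank M <= k)%N).
- by rewrite mxrank0.
- by move=> M k N l Mk Nl; apply: leq_trans (mxrank_add _ _) (leq_add Mk Nl).
by move=> i _; apply: leq_trans (mxrankM_maxr _ _) (rank_leq_row _).
Qed.

(** Selecting rows and columns is multiplication by matrices on either side, which cannot raise the
    rank. *)
Lemma det_sub_small_rank (F : fieldType) n j (L : 'M[F]_n) (f g : 'I_j -> 'I_n) :
  (\rank L < j)%N -> \det (\matrix_(a, b) L (f a) (g b)) = 0.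
Proof.
move=> Lj; apply/eqP; rewrite -[_ == 0]negbK -unitfE -unitmxE -row_free_unit.
apply/negP => /eqP rj; move: Lj; rewrite ltnNge -[X in (X <= _)%N]rj => /negP; apply.
have -> : \matrix_(a, b) L (f a) (g b) =
    rowsub f 1%:M *m L *m colsub g 1%:M.
  rewrite mul_rowsub_mx mul1mx mulmx_colsub mulmx1.
  by apply/matrixP => a b; rewrite !mxE.
by apply: leq_trans (mxrankM_maxl _ _) (mxrankM_maxr _ _).
Qed.

(** * Upper bound on the co-rank *)

(** At a rational point where [genLap e] has rank below [j], all [j]-minors vanish, and the ideal
    identity would read 0 = 1. *)
Lemma corank_le n (e : rel 'I_n) (h : 'I_n -> nat) (A : {set 'I_n}) j :
    simple_graph e -> injective h -> critical_ideal_trivial e j ->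
  (j <= #|~: A|.*2 + #|ascents h (induced e A)|)%N.
Proof.
move=> [esym eirr] hinj [c ideal1]; rewrite leqNgt; apply/negP => small.
set E := ascents h (induced e A) in small.
(* [w p] is the signed incidence vector of the edge [p], so [x i] is the degree of [i] in T[A]. *)
pose w (p : 'I_n * 'I_n) (i : 'I_n) : rat := (i == p.1)%:R - (i == p.2)%:R.
pose x i := \sum_(p in E) w p i * w p i.
pose ev : {rmorphism {mpoly int[n]} -> rat} := mmap (intmul 1 : int -> rat) x.
pose L := map_mx ev (genLap e).
have LE i k : L i k = if i == k then x i else - (e i k)%:R.
  rewrite !mxE; case: eqP => _; last by rewrite rmorphN rmorph_nat.
  by rewrite /ev /= mmapX mmap1U.
suff rankL : (\rank L <= #|~: A|.*2 + #|E|)%N.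
  move/eqP: (congr1 ev ideal1); rewrite rmorph1 rmorph_sum big1 ?(eq_sym 0) ?oner_eq0 //.
  move=> p _; rewrite rmorphM /minor -det_map_mx.
  have -> : map_mx ev (\matrix_(a, b) genLap e (p.1 a) (p.2 b)) =
      \matrix_(a, b) L (p.1 a) (p.2 b) by apply/matrixP => a b; rewrite !mxE.
  by rewrite det_sub_small_rank ?mulr0 // (leq_ltn_trans rankL).
pose colA v : 'cV[rat]_n := \col_i (if i \in A then L i v else 0).
(* Rows outside [A], then columns outside [A] cut to rows in [A] to avoid overlap, then the
   Laplacian of T[A] as a sum of rank-one terms. *)
have -> : L = (\sum_(v in ~: A) delta_mx v 0 *m row v L
             + \sum_(v in ~: A) colA v *m delta_mx 0 v)
             + \sum_(p in E) (\col_i w p i) *m (\row_i w p i).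
  apply/matrixP => i k; rewrite [RHS]mxE [X in _ = X + _]mxE !summxE.
  have -> : \sum_(v in ~: A) (delta_mx v 0 *m row v L) i k =
      if i \in A then 0 else L i k.
    rewrite big_mkcond (bigD1 i) //= big1 ?addr0 => [|v vi].
      by rewrite inE; case: (i \in A); rewrite // mxE big_ord1 !mxE !eqxx mul1r.
    case: ifP => // _; rewrite mxE big_ord1 !mxE eq_sym (negPf vi) mul0r //.
  have -> : \sum_(v in ~: A) (colA v *m delta_mx 0 v) i k =
      if (i \in A) && (k \notin A) then L i k else 0.
    rewrite big_mkcond (bigD1 k) //= big1 ?addr0 => [|v vk].
      rewrite inE andbC; case: (k \in A); rewrite //= mxE big_ord1 !mxE !eqxx mulr1.
      by [].
    case: ifP => // _; rewrite mxE big_ord1 !mxE [k == v]eq_sym (negPf vk) andbF mulr0 //.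
  under eq_bigr do rewrite mxE big_ord1 !mxE.
  have w0 p l : l \notin A -> p \in E -> w p l = 0.
    rewrite inE => lA /and4P[_ p1A p2A _]; rewrite /w.
    have lneq z : z \in A -> (l == z) = false by move=> zA; apply: contraNF lA => /eqP->.
    by rewrite !lneq ?subrr.
  have [iA|iA] := boolP (i \in A); last first.
    by rewrite /= big1 ?addr0 // => p pE; rewrite w0 ?mul0r.
  have [kA|kA] := boolP (k \in A); last first.
    by rewrite /= big1 ?addr0 ?add0r // => p pE; rewrite [w p k]w0 ?mulr0.
  rewrite /= !add0r LE; have [<- //|ik] := eqVneq i k.
  (* Off the diagonal, only the edge joining [i] and [k], listed as [q], contributes to the
     Laplacian entry. *)
  pose q := if (h i < h k)%N then (i, k) else (k, i).
  have qE : (q \in E) = e i k.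
    rewrite /q; case: ltnP => hik; rewrite inE /induced /= iA kA ?hik //= esym.
    by rewrite ltn_neqAle hik andbT; case: eqP => // /hinj ki; rewrite ki eqxx in ik.
  rewrite (eq_bigr (fun p => - (p == q)%:R)) => [|[a b]].
    rewrite sumrN; congr (- _); rewrite -qE.
    have [qE'|qE'] := boolP (q \in E).
      by rewrite (bigD1 q) //= eqxx big1 ?addr0 // => p /andP[_ /negPf->].
    by rewrite big1 // => p pE; case: eqP => // pq; rewrite -pq pE in qE'.
  rewrite inE /w /q /= => /and4P[hab _ _ eab].
  have ab : a != b by apply/eqP => ab; rewrite ab eirr in eab.
  have not2 (y z y' z' : 'I_n) : (y = z -> y' = z' -> False) -> ~~ ((y == z) && (y' == z')).
    by move=> yz; apply/negP => /andP[/eqP+ /eqP]; apply: yz.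
  (* [F1] to [F5] exclude the impossible coincidences; the remaining truth values are checked one by
     one. *)
  have F1 : ~~ ((i == a) && (i == b)) by apply: not2 => ia ib; rewrite -ia -ib eqxx in ab.
  have F2 : ~~ ((k == a) && (k == b)) by apply: not2 => ia ib; rewrite -ia -ib eqxx in ab.
  have F3 : ~~ ((i == a) && (k == a)) by apply: not2 => ia ka; rewrite ia ka eqxx in ik.
  have F4 : ~~ ((i == b) && (k == b)) by apply: not2 => ia ka; rewrite ia ka eqxx in ik.
  have [F5 ->] : ~~ (if (h i < h k)%N then (i == b) && (k == a) else (i == a) && (k == b)) /\
      ((a, b) == if (h i < h k)%N then (i, k) else (k, i)) =
      if (h i < h k)%N then (i == a) && (k == b) else (k == a) && (i == b).
    case: ltnP => hik; rewrite xpair_eqE !(eq_sym a) !(eq_sym b); split=> //; apply: not2.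
      by move=> ib ka; rewrite ib ka ltnNge ltnW in hik.
    by move=> ia kb; rewrite ia kb leqNgt hab in hik.
  move: F1 F2 F3 F4 F5.
  case: (i == a); case: (i == b); case: (k == a); case: (k == b); case: (h i < h k)%N => //= _ _ _ _ _;
    by rewrite ?(subr0, sub0r, mul0r, mulr0, mulr1, mul1r, oppr0).
apply: leq_trans (mxrank_add _ _) _; rewrite -addnn.
apply: leq_add; last exact: mxrank_sum_outer.
by apply: leq_trans (mxrank_add _ _) _; apply: leq_add; apply: mxrank_sum_outer.
Qed.

(** * Lower bound: a triangular minor *)

(** Along oriented paths a vertex is the tail of at most one arc and the head of at most one, so
    tails and heads index distinct rows and columns. *)
Lemma oriented_minor n (e : rel 'I_n) (h : 'I_n -> nat) (m : rel 'I_n) :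
    simple_graph e -> elimination_order e h -> ssrbool.symmetric m -> subrel m e ->
    (forall w, #|[set u | m w u]| <= 2)%N ->
  critical_ideal_trivial e #|ascents h m| /\ (#|ascents h m| <= n)%N.
Proof.
move=> [esm eirr] hord msym me mdeg.
have [dir [dir_up dir_sib]] := two_matching_orientation hord msym me mdeg.
have [hinj hup] := hord.
set C := ascents h m; pose j := #|C|.
have CP p : p \in C -> m p.1 p.2 /\ (h p.1 < h p.2)%N by rewrite inE => /andP[].
have par p v : p \in C -> e p.1 v -> (h p.1 < h v)%N -> v = p.2.
  by move=> /CP[/me ep hp] ev hv; apply: hup ev ep hv hp.
pose tl (p : 'I_n * 'I_n) := if dir p.1 then p.2 else p.1.
pose hd (p : 'I_n * 'I_n) := if dir p.1 then p.1 else p.2.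
have inj2 p q : p \in C -> q \in C -> p.1 = q.1 -> p = q.
  move=> /CP[/me pe hp] /CP[/me qe hq] pq.
  rewrite [p]surjective_pairing [q]surjective_pairing -pq; congr (_, _).
  by apply: hup pe _ hp _; rewrite pq.
have chain p q : p \in C -> q \in C -> p.2 = q.1 -> dir p.1 = dir q.1.
  by move=> /CP[mp hp] /CP[mq hq] pq; rewrite -pq in mq hq *; apply: dir_up mp mq hp hq.
have sib p q : p \in C -> q \in C -> p.2 = q.2 -> dir p.1 = dir q.1 -> p = q.
  move=> pC qC pq dpq; apply: inj2 => //; apply/eqP/negPn/negP => npq.
  have [mp hp] := CP _ pC; have [mq hq] := CP _ qC; rewrite -pq in mq hq.
  by have := dir_sib _ _ _ mp mq hp hq npq; rewrite dpq eqxx.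
have tl_inj : {in C &, injective tl}.
  move=> p q pC qC; rewrite /tl; case dp: (dir p.1); case dq: (dir q.1) => pq.
  - by apply: sib; rewrite ?dp ?dq.
  - by have := chain p q pC qC pq; rewrite dp dq.
  - by have := chain q p qC pC (esym pq); rewrite dp dq.
  exact: inj2.
have hd_inj : {in C &, injective hd}.
  move=> p q pC qC; rewrite /hd; case dp: (dir p.1); case dq: (dir q.1) => pq.
  - exact: inj2.
  - by have := chain q p qC pC (esym pq); rewrite dp dq.
  - by have := chain p q pC qC pq; rewrite dp dq.
  by apply: sib; rewrite ?dp ?dq.
pose N := (\max_i h i).+1.
have hN i : (h i < N)%N by rewrite ltnS; apply: leq_bigmax.
(* Downward arcs come first, by increasing height; then upward arcs, by
   decreasing height. *)
pose rk (p : 'I_n * 'I_n) := if dir p.1 then h p.1 else (N + (N - h p.1))%N.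
have adj u v : (u == v) || e u v -> [\/ u = v, e u v /\ (h u < h v)%N | e v u /\ (h v < h u)%N].
  case/predU1P=> [->|uv]; first by constructor 1.
  have [huv|huv|/hinj uvE] := ltngtP (h u) (h v); [by constructor 2| |by constructor 1].
  by constructor 3; rewrite esm.
(* Where the rank does not grow, uniqueness of parents forces [p = q] or gives consecutive arcs with
   different [dir]. *)
have ranked p q : p \in C -> q \in C -> p != q ->
    (tl p == hd q) || e (tl p) (hd q) -> (rk p < rk q)%N.
  move=> pC qC pq /adj; have [_ hp] := CP p pC; have [_ hq] := CP q qC.
  rewrite /tl /hd /rk; case dp: (dir p.1); case dq: (dir q.1).
  - case=> [<- //|[_ pq2]|[eqp hqp]]; first exact: ltn_trans pq2.
    by case/eqP: pq; apply: sib; rewrite ?dp ?dq // (par q p.2).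
  - by move=> _; apply: leq_trans (leq_addr _ _).
  - case=> [pq1|[epq hpq]|[eqp hqp]].
    + by case/eqP: pq; apply: inj2.
    + by have := chain p q pC qC (esym (par _ _ pC epq hpq)); rewrite dp dq.
    by have := chain q p qC pC (esym (par _ _ qC eqp hqp)); rewrite dp dq.
  case=> [pq1|[epq hpq]|[eqp hqp]]; rewrite ltn_add2l ltn_sub2l ?hN //.
  - by rewrite pq1.
  - by case/eqP: pq; apply: sib; rewrite ?dp ?dq // (par p q.2).
  exact: ltn_trans hqp.
pose pr (a : 'I_j) := enum_val a : 'I_n * 'I_n.
have prC a : pr a \in C by apply: enum_valP.
have pr_inj : injective pr by apply: enum_val_inj.
pose f := [ffun a : 'I_j => tl (pr a)]; pose g := [ffun a : 'I_j => hd (pr a)].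
have finj : injective f.
  by move=> a b; rewrite !ffunE => /(tl_inj _ _ (prC a) (prC b))/pr_inj.
have ginj : injective g.
  by move=> a b; rewrite !ffunE => /(hd_inj _ _ (prC a) (prC b))/pr_inj.
have minorE : minor (genLap e) f g = (-1) ^+ j.
  rewrite /minor (@det_ranked _ _ _ (fun a => rk (pr a))) => [|a b ab].
    rewrite -[in RHS](card_ord j) -prodr_const; apply: eq_bigr => a _.
    rewrite !mxE !ffunE /tl /hd; have [/me ep hp] := CP _ (prC a).
    have np : (pr a).1 != (pr a).2 by apply/eqP => pE; rewrite pE eirr in ep.
    by case: (dir _); [rewrite eq_sym esm|]; rewrite (negPf np) ep.
  rewrite !mxE !ffunE => nz; apply: ranked; rewrite ?prC ?(inj_eq pr_inj) //.
  by move: nz; case: (tl _ == _) => //=; case: (e _ _); rewrite // oppr0 eqxx.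
(* The tails are distinct vertices, so [j] lies in the range of the maximum in [gamma]. The minor is
   a sign, hence its own inverse. *)
split; last by have := leq_card f finj; rewrite !card_ord.
exists [ffun p => if p == (f, g) then (-1) ^+ j else 0].
rewrite (bigD1 (f, g)) /=; last by apply/andP; split; apply/injectiveP.
rewrite ffunE eqxx minorE -expr2 sqrr_sign big1 ?addr0 // => p /andP[_ /negPf pfg].
by rewrite ffunE pfg mul0r.
Qed.

(** * The equality for trees *)

Lemma propbP (P : Prop) : reflect P (propb P).
Proof. by rewrite /propb; case: excluded_middle_informative; constructor. Qed.

Local Close Scope ring_scope.

Theorem theorem3p8 (n : nat) (e : rel 'I_n) :
  is_tree e -> gamma e = nu2 e.
Proof.
case=> esimp _ eacy; have [esm eirr] := esimp.
have [h hord] := acyclic_elimination_order esimp eacy; have [hinj _] := hord.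
have [A AE] := greedy_set e h.
apply/eqP; rewrite eqn_leq; apply/andP; split.
  apply: leq_trans (greedy_matching esimp hord AE).
  by apply/bigmax_leqP => j /propbP; apply: corank_le.
apply/bigmax_leqP => M /andP[/forall_inP Medge /forallP Mdeg].
(* The symmetric closure forgets the index order built into [M], so that [h] can replace it. *)
pose m u v := ((u, v) \in M) || ((v, u) \in M).
have msym : ssrbool.symmetric m by move=> u v; rewrite /m orbC.
have me : subrel m e.
  by move=> u v /orP[] /Medge /andP[_] //; rewrite esm.
have mirr : ssrbool.irreflexive m.
  by move=> u; apply: contraFF (eirr u) => /me.
have Mm : M = ascents (@nat_of_ord n) m.
  apply/setP => -[u v]; rewrite inE /m /=; apply/idP/andP => [uv|[uv /orP[//|vu]]].
    by rewrite uv; have /andP[] := Medge _ uv.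
  by have /andP[/= vu' _] := Medge _ vu; rewrite ltnNge ltnW in uv.
have mdeg w : #|[set u | m w u]| <= 2.
  by rewrite -(ascents_degree w (@ord_inj n)) // -Mm; apply: Mdeg.
have [triv ltn] := oriented_minor esimp hord msym me mdeg.
have -> : #|M| = #|ascents h m|.
  by rewrite Mm; apply/eqP; rewrite eqn_leq !card_ascents //; apply: ord_inj.
by apply: (leq_bigmax_cond (Ordinal (ltn : _ < n.+1))); apply/propbP.
Qed.
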